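(* Let $\mathcal{T}$ be a stacked component (the graph specified in the context) and suppose the new edge $\mathcal{E}$, which joins two distinct floor vertices, has both of its endpoints in $\mathcal{T}$. Let $\mathcal{T}+\mathcal{E}$ be the graph obtained from $\mathcal{T}$ by adding the edge $\mathcal{E}$. Then $\mathrm{diam}(\mathcal{T}+\mathcal{E})=\mathrm{diam}(\mathcal{T})$.
   Context: Let $p$ be a prime with $p\equiv 71$ or $119\pmod{120}$, let $\ell=2$, and let $\mathrm{ord}(\ell)$ be the order, in the ideal class group of $\mathbb{Q}(\sqrt{-p})$, of a prime ideal above $2$; it is an odd integer $\ge 3$. A stacked component $\mathcal{T}$ (a component of the supersingular $2$-isogeny graph over $\mathbb{F}_p$ after identifying curves up to $\overline{\mathbb{F}_p}$-isomorphism, regarded as a simple undirected graph) is, writing $L=\mathrm{ord}(\ell)$, labelled so that $V(\mathcal{T})=\{0,1,\dots,2L-1\}$ and $$E(\mathcal{T})=\{\{2i,2i+1\}:0\le i\le L-1\}\cup\{\{2i+1,2i+3\}:0\le i\le L-2\}\cup\{\{2L-1,1\}\}.$$ The floor vertices of $\mathcal{T}$ are the even vertices. The new edge $\mathcal{E}$ is the single edge coming from $2$-isogenies not defined over $\mathbb{F}_p$ that must be added to obtain the spine; its endpoints are always two distinct floor vertices, and here it is treated as an arbitrary edge joining two distinct floor vertices. The diameter is the maximum graph distance between two vertices. *)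

(* Defs.v *)
From mathcomp Require Import all_boot all_order all_algebra all_field.
From mathcomp Require Import boolp classical_sets.

Set Implicit Arguments.
Unset Strict Implicit.
Unset Printing Implicit Defensive.

Import Order.TTheory GRing.Theory Num.Theory.

Section ImaginaryQuadratic.
Local Open Scope ring_scope.
Local Open Scope classical_set_scope.

(* The field Q(sqrt(-d)), as a subset of the complex algebraic numbers. *)
Definition imag_quad_field (d : nat) : set algC :=
  [set x | exists a b : rat, x = ratr a + ratr b * sqrtC (- d%:R)].

Definition ring_of_integers (K : set algC) : set algC :=
  K `&` [set x | x \in Aint].

Definition is_ideal (O I : set algC) : Prop :=
  [/\ I `<=` O, I 0, forall x y, I x -> I y -> I (x + y)
    & forall c x, O c -> I x -> I (c * x)].

Definition is_prime_ideal (O I : set algC) : Prop :=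
  [/\ is_ideal O I, ~ I 1
    & forall x y, O x -> O y -> I (x * y) -> I x \/ I y].

Definition prime_ideal_above (O : set algC) (l : nat) (P : set algC) : Prop :=
  is_prime_ideal O P /\ P l%:R.

Definition ideal_mul (I J : set algC) : set algC :=
  [set x | exists2 s : seq (algC * algC),
      forall u, u \in s -> I u.1 /\ J u.2
    & x = \sum_(u <- s) u.1 * u.2].

Definition ideal_exp (O I : set algC) (n : nat) : set algC :=
  iter n (ideal_mul I) O.

(* Equality of ideal classes: a I = b J for some nonzero a, b in O. *)
Definition ideal_equiv (O I J : set algC) : Prop :=
  exists a b : algC,
    [/\ O a, O b, a != 0, b != 0
      & [set a * x | x in I] = [set b * y | y in J]].

(* n is the (finite) order of the class of I; the neutral class is that of O. *)
Definition is_class_order (O I : set algC) (n : nat) : Prop :=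
  [/\ (0 < n)%N, ideal_equiv O (ideal_exp O I n) O
    & forall m, (0 < m)%N -> ideal_equiv O (ideal_exp O I m) O -> (n <= m)%N].

End ImaginaryQuadratic.

Section Graphs.
Local Open Scope nat_scope.

Definition has_walk (V : finType) (e : rel V) (x y : V) (n : nat) : bool :=
  [exists q : n.-tuple V, path e x q && (last x q == y)].

(* The least length of a walk from x to y. Vertices joined by some walk are
   joined by one of length < #|V|, so the value #|V| is taken exactly when x
   and y lie in different components. *)
Definition dist (V : finType) (e : rel V) (x y : V) : nat :=
  find (has_walk e x y) (iota 0 #|V|).

Definition diam (V : finType) (e : rel V) : nat :=
  \max_(x : V) \max_(y : V) dist e x y.

Definition add_edge (V : finType) (e : rel V) (a b : V) : rel V :=
  fun u v => [|| e u v, (u == a) && (v == b) | (u == b) && (v == a)].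

Definition stacked_arc (L u v : nat) : bool :=
  [|| [exists i : 'I_L, (u == 2 * i) && (v == 2 * i + 1)],
      [exists i : 'I_L.-1, (u == 2 * i + 1) && (v == 2 * i + 3)]
    | (u == 2 * L - 1) && (v == 1)].

Definition stacked_component (L : nat) : rel 'I_(2 * L) :=
  fun u v => stacked_arc L u v || stacked_arc L v u.

Definition is_floor (L : nat) (u : 'I_(2 * L)) : bool := ~~ odd u.

End Graphs.

(* Main.v *)
(* In the component each floor vertex is pendant on a vertex of a cycle of
   length L, so the diameter is at most floor(L/2) + 2, and adding an edge cannot
   increase it. Conversely, choose a floor vertex x, distinct from the endpoints
   of the new edge, above the midpoint of an arc of the cycle between them: the
   two endpoints are almost equidistant from x, so the distance to x remains
   1-Lipschitz after the edge is added, and the floor vertex opposite to x stays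
   at distance floor(L/2) + 2 from it. Such an x exists for L >= 3, whereas
   the equality fails for L = 2. Arithmetic excludes L = 2: if P^2 = (g) then
   g divides 4, so its norm is at most 16; as p > 64 this makes g an integer,
   and g is even because it lies in P. Hence 2 divides the square of every
   element of P, but P contains (1 + sqrt(-p))/2 or its conjugate, the square of
   which is not divisible by 2. *)

Require Import Defs.
From mathcomp Require Import all_boot all_order all_algebra all_field.
From mathcomp Require Import boolp classical_sets.
From mathcomp Require Import zify ring.

Set Implicit Arguments.
Unset Strict Implicit.
Unset Printing Implicit Defensive.

(** * Distances in the stacked component *)

Section Distance.
Variables (V : finType) (e : rel V).

Lemma has_walkP (x y : V) (n : nat) :
  reflect (exists q, [/\ size q = n, path e x q & last x q = y])
          (has_walk e x y n).
Proof.
apply: (iffP existsP) => [[q /andP[eq_q /eqP last_q]]|[q [sz_q eq_q last_q]]].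
  by exists q; rewrite size_tuple.
by exists (tcast sz_q (in_tuple q)); rewrite val_tcast eq_q last_q eqxx.
Qed.

Lemma has_walk0 (x : V) : has_walk e x x 0.
Proof. by apply/has_walkP; exists [::]. Qed.

Lemma has_walk1 (x y : V) : e x y -> has_walk e x y 1.
Proof. by move=> exy; apply/has_walkP; exists [:: y]; rewrite /= exy. Qed.

Lemma has_walk_cat (x y z : V) (m n : nat) :
  has_walk e x y m -> has_walk e y z n -> has_walk e x z (m + n).
Proof.
move=> /has_walkP[q [<- eq_q last_q]] /has_walkP[r [<- er last_r]].
apply/has_walkP; exists (q ++ r).
by rewrite size_cat cat_path last_cat last_q eq_q er.
Qed.

Lemma has_walk_sym (x y : V) (n : nat) :
  symmetric e -> has_walk e x y n -> has_walk e y x n.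
Proof.
move=> e_sym; elim: n x => [|n IHn] x /has_walkP[[|z q] [//= sz_q]].
  by move=> _ <-; apply: has_walk0.
case/andP=> exz eq_q last_q; rewrite -addn1; apply: (@has_walk_cat _ z).
  by apply: IHn; apply/has_walkP; exists q; case: sz_q.
by apply: has_walk1; rewrite e_sym.
Qed.

Lemma dist_le (x y : V) (n : nat) : has_walk e x y n -> dist e x y <= n.
Proof.
move=> walk_n; rewrite leqNgt; apply/negP => n_lt.
have n_small : n < #|V|.
  by apply: leq_trans n_lt _; rewrite -[leqRHS](size_iota 0) find_size.
by move: (before_find 0 n_lt); rewrite nth_iota // walk_n.
Qed.

(** The bound by [#|V|] accounts for the default value of [dist] when no walk joins the two
    vertices. *)
Lemma dist_ge (x y : V) (n : nat) :
    n <= #|V| -> (forall m, has_walk e x y m -> n <= m) ->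
  n <= dist e x y.
Proof.
move=> n_le min_n; rewrite leqNgt; apply/negP => dist_lt.
have has_w : has (has_walk e x y) (iota 0 #|V|).
  by rewrite has_find size_iota; apply: leq_trans dist_lt _.
have := nth_find 0 has_w; rewrite -/(dist e x y) nth_iota => [/min_n|].
  by rewrite leqNgt dist_lt.
exact: leq_trans dist_lt _.
Qed.

(** Source of lower bounds on distances: a potential that rises by at most one along each edge
    limits how far a walk can climb. *)
Lemma has_walk_lipschitz (f : V -> nat) (x y : V) (n : nat) :
    (forall u v, e u v -> f v <= (f u).+1) -> has_walk e x y n ->
  f y <= f x + n.
Proof.
move=> f_lip /has_walkP[q [<- eq_q <-]].
elim: q x eq_q => [|z q IHq] x /=; first by rewrite addn0.
by move=> /andP[/f_lip f_z /IHq]; lia.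
Qed.

Lemma dist_le_diam (x y : V) : dist e x y <= diam e.
Proof.
apply: leq_trans (@leq_bigmax V (dist e x) y) _.
exact: (@leq_bigmax V (fun u => \max_v dist e u v) x).
Qed.

Lemma diam_le (n : nat) : (forall x y, dist e x y <= n) -> diam e <= n.
Proof. by move=> dist_n; apply/bigmax_leqP => x _; apply/bigmax_leqP => y _. Qed.

End Distance.

Lemma dist_subrel (V : finType) (e e' : rel V) (x y : V) :
  subrel e e' -> dist e' x y <= dist e x y.
Proof.
move=> sub_e; apply: sub_find => n /has_walkP[q [sz_q eq_q last_q]].
by apply/has_walkP; exists q; rewrite (sub_path sub_e).
Qed.

(** * Arcs of the stacked component, and an upper bound for its diameter *)

Lemma stacked_arcP (L u v : nat) :
  reflect [\/ exists i, [/\ i < L, u = 2 * i & v = 2 * i + 1],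
              exists i, [/\ i.+1 < L, u = 2 * i + 1 & v = 2 * i + 3]
            | u = 2 * L - 1 /\ v = 1]
          (stacked_arc L u v).
Proof.
apply: (iffP or3P).
  case=> [/existsP[i /andP[/eqP u_i /eqP v_i]]
         |/existsP[i /andP[/eqP u_i /eqP v_i]]|/andP[/eqP-> /eqP->]].
  - by constructor 1; exists i.
  - by constructor 2; exists i; split=> //; have := ltn_ord i; lia.
  - by constructor 3.
case=> [[i [lt_i -> ->]]|[i [lt_i -> ->]]|[-> ->]].
- by constructor 1; apply/existsP; exists (Ordinal lt_i); rewrite !eqxx.
- have lt_i' : i < L.-1 by lia.
  by constructor 2; apply/existsP; exists (Ordinal lt_i'); rewrite !eqxx.
- by constructor 3; rewrite !eqxx.
Qed.

Lemma stacked_component_sym (L : nat) : symmetric (@stacked_component L).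
Proof. by move=> u v; rewrite /stacked_component orbC. Qed.

(** Length of the shorter arc between two positions on a cycle of length [L]. Since natural
    subtraction truncates, the sum of the two differences is |i - j|. *)
Definition cyc_dist (L i j : nat) : nat :=
  minn ((i - j) + (j - i)) (L - ((i - j) + (j - i))).

Lemma roof_walk_forward (L : nat) (u v : 'I_(2 * L)) (n : nat) :
  odd u -> v = u + 2 * n :> nat -> has_walk (@stacked_component L) u v n.
Proof.
move=> odd_u; elim: n v => [|n IHn] v v_eq.
  have -> : v = u by apply: val_inj; rewrite /= v_eq; lia.
  exact: has_walk0.
have lt_w : u + 2 * n < 2 * L by have := ltn_ord v; lia.
rewrite -[n.+1]addn1; apply: (@has_walk_cat _ _ _ (Ordinal lt_w)); first exact: IHn.
apply: has_walk1; apply/orP; left; apply/stacked_arcP; constructor 2.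
by exists (u./2 + n); rewrite /=; have := ltn_ord v; split; lia.
Qed.

Lemma roof_walk (L : nat) (u v : 'I_(2 * L)) :
    odd u -> odd v ->
  has_walk (@stacked_component L) u v (cyc_dist L u./2 v./2).
Proof.
wlog le_uv : u v / u <= v.
  move=> walk_le odd_u odd_v; have [/walk_le|/ltnW/walk_le] := leqP u v.
    exact.
  move=> /(_ odd_v odd_u) /(has_walk_sym (@stacked_component_sym L)).
  by rewrite {1}/cyc_dist addnC.
move=> odd_u odd_v; have lt_v := ltn_ord v.
rewrite /cyc_dist; case: leqP => _.
  by apply: roof_walk_forward => //; lia.
(* When the complementary arc is the shorter one, walk from [v] up to [2 * L - 1], across the
   closing edge to 1, then up to [u]. *)
have lt_1 : 1 < 2 * L by lia.
have lt_last : 2 * L - 1 < 2 * L by lia.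
apply: has_walk_sym; first exact: stacked_component_sym.
have -> : L - (u./2 - v./2 + (v./2 - u./2)) = (L - 1 - v./2) + (1 + u./2).
  by lia.
apply: (@has_walk_cat _ _ _ (Ordinal lt_last)).
  by apply: roof_walk_forward => //=; lia.
apply: (@has_walk_cat _ _ _ (Ordinal lt_1)); last first.
  by apply: roof_walk_forward => //=; lia.
apply: has_walk1; apply/orP; left; apply/stacked_arcP.
by constructor 3.
Qed.

Lemma walk_to_roof (L : nat) (u : 'I_(2 * L)) :
  exists (r : 'I_(2 * L)) (n : nat),
    [/\ odd r, r./2 = u./2, n <= 1 & has_walk (@stacked_component L) u r n].
Proof.
have lt_u := ltn_ord u; have [odd_u|even_u] := boolP (odd u).
  by exists u, 0; split=> //; apply: has_walk0.
have lt_r : u.+1 < 2 * L by lia.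
exists (Ordinal lt_r), 1; split=> //=; try lia.
apply: has_walk1; apply/orP; left; apply/stacked_arcP; constructor 1.
by exists u./2 => /=; split; lia.
Qed.

Lemma diam_stacked_le (L : nat) : diam (@stacked_component L) <= L./2 + 2.
Proof.
apply: diam_le => x y.
have [r [m [odd_r r_x m_le walk_xr]]] := walk_to_roof x.
have [s [n [odd_s s_y n_le walk_ys]]] := walk_to_roof y.
have walk_sy := has_walk_sym (@stacked_component_sym L) walk_ys.
have walk_xy := has_walk_cat (has_walk_cat walk_xr (roof_walk odd_r odd_s)) walk_sy.
apply: leq_trans (dist_le walk_xy) _.
by rewrite /cyc_dist; lia.
Qed.

(* Graph distance to the floor vertex [2 * i] in the stacked component. *)
Definition height (L i v : nat) : nat :=
  if v == 2 * i then 0 else cyc_dist L i v./2 + (if odd v then 1 else 2).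

(** A cycle edge, the closing one included, changes the cyclic distance by at most one; a pendant
    edge keeps the cyclic index and only changes the added constant. *)
Lemma height_stacked (L i : nat) (u v : 'I_(2 * L)) :
  i < L -> stacked_component u v -> height L i v <= (height L i u).+1.
Proof.
move=> lt_i; have lt_u := ltn_ord u; have lt_v := ltn_ord v.
rewrite /height /cyc_dist.
case/orP=> /stacked_arcP[[j [lt_j -> ->]]|[j [lt_j -> ->]]|[-> ->]];
  do ! case: ifP => ? /=; lia.
Qed.

(* The midpoint of an arc of length at least 2 is not an endpoint of it; for
   [L >= 3] one of the two arcs joining distinct points is that long. *)
Lemma equidistant_index (L i j : nat) :
    2 < L -> i < L -> j < L -> i != j ->
  exists k, [/\ k < L, k != i, k != j,
    cyc_dist L k i <= (cyc_dist L k j).+1 &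
    cyc_dist L k j <= (cyc_dist L k i).+1].
Proof.
move=> L_gt2; wlog lt_ij : i j / i < j.
  move=> wl lt_i lt_j ne_ij; have [lt|le] := ltnP i j; first exact: wl.
  by have [||||k []] := wl j i; try lia; exists k.
move=> lt_i lt_j _; have [arc2|arc1] := leqP 2 (j - i).
  by exists (i + j)./2; rewrite /cyc_dist; split; lia.
(* Here j = i + 1, so the arc from j round to i + L has length L - 1, at least 2. Its midpoint is
   reduced modulo L. *)
have [wrap|nowrap] := leqP L (i + j + L)./2.
  by exists ((i + j + L)./2 - L); rewrite /cyc_dist; split; lia.
by exists (i + j + L)./2; rewrite /cyc_dist; split; lia.
Qed.

Lemma diam_stacked_add_edge (L : nat) (a b : 'I_(2 * L)) :
    L != 2 -> is_floor a -> is_floor b -> a != b ->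
  diam (add_edge (@stacked_component L) a b) = diam (@stacked_component L).
Proof.
rewrite /is_floor => L_ne2 floor_a floor_b; rewrite -val_eqE /= => ne_ab.
have lt_a := ltn_ord a; have lt_b := ltn_ord b.
apply/eqP; rewrite eqn_leq; apply/andP; split.
  apply: diam_le => x y; apply: leq_trans (dist_le_diam _ x y).
  by apply: dist_subrel => u v euv; rewrite /add_edge euv.
(* Two distinct floor vertices force L >= 2, hence L >= 3 as L = 2 is excluded. *)
have [||||k [lt_k ne_ka ne_kb le_ab le_ba]] := @equidistant_index L a./2 b./2;
  try lia.
have lt_x : 2 * k < 2 * L by lia.
(* The antipode of [k] on the cycle, reduced modulo [L]. *)
have [l [lt_l dist_kl]] : exists l, l < L /\ cyc_dist L k l = L./2.
  have [wrap|nowrap] := leqP L (k + L./2).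
    by exists (k + L./2 - L); rewrite /cyc_dist; lia.
  by exists (k + L./2); rewrite /cyc_dist; lia.
have lt_y : 2 * l < 2 * L by lia.
pose x := Ordinal lt_x; pose y := Ordinal lt_y.
apply: leq_trans (diam_stacked_le L) (leq_trans _ (dist_le_diam _ x y)).
apply: dist_ge => [|n walk_n]; first by rewrite card_ord; lia.
(* Both ends of the new edge are floor vertices other than [x], so their heights are cyclic
   distances plus 2, which differ by at most one by the choice of [k]. *)
have lip u v : add_edge (@stacked_component L) a b u v ->
    height L k v <= (height L k u).+1.
  by case/or3P=> [/(height_stacked lt_k)//||] /andP[/eqP-> /eqP->];
    rewrite /height; do ! case: ifP => ?; lia.
have := has_walk_lipschitz (f := fun v : 'I_(2 * L) => height L k v) lip walk_n.
have -> : height L k x = 0 by rewrite /height eqxx.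
have -> // : height L k y = L./2 + 2.
have ne_yx : (2 * l == 2 * k) = false.
  by apply/eqP => eq_yx; move: dist_kl; rewrite /cyc_dist; lia.
by rewrite /height /= ne_yx oddM mul2n doubleK dist_kl.
Qed.

(** * The class of a prime above 2 does not have order 2 *)

Section QuadraticIntegers.
Import Order.TTheory GRing.Theory Num.Theory.
Local Open Scope ring_scope.

Local Notation sqrtN d := (sqrtC (- d%:R) : algC).
Local Notation quad_int d := (ring_of_integers (imag_quad_field d)).

(** * Integrality, trace and norm in imaginary quadratic fields *)

(** Conjugation preserves the square -d, so it fixes or negates the root; for d > 0 a fixed root
    would be real with a negative square. *)
Lemma conj_sqrtN (d : nat) : (sqrtN d)^* = - sqrtN d.
Proof.
have [->|d_gt0] := posnP d; first by rewrite oppr0 sqrtC0 conjC0 oppr0.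
have : ((sqrtN d)^*) ^+ 2 == (sqrtN d) ^+ 2.
  by rewrite -rmorphXn /= sqrtCK rmorphN rmorph_nat.
rewrite eqf_sqr => /orP[/eqP /CrealP root_real|/eqP //].
have := real_exprn_even_ge0 (n := 2) root_real isT.
by rewrite sqrtCK oppr_ge0 lern0; case: (d) d_gt0.
Qed.

Lemma Aint_quadratic (b c : int) (x : algC) :
  x ^+ 2 + b%:~R * x + c%:~R = 0 -> x \in Aint.
Proof.
move=> x_root.
have monic_p : ('X^2 + b%:~R%:P * 'X + c%:~R%:P : {poly algC}) \is monic.
  rewrite monicE -addrA lead_coefDl ?lead_coefXn // size_polyXn.
  apply: leq_ltn_trans (size_polyD _ _) _; rewrite gtn_max.
  rewrite (leq_ltn_trans (size_polyC_leq1 _)) // mul_polyC.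
  by rewrite (leq_ltn_trans (size_scale_leq _ _)) // size_polyX.
apply: (root_monic_Aint _ monic_p); first by rewrite /root !hornerE x_root.
apply/polyOverP => i; rewrite !coefE.
by case: ifP => _; rewrite !rpredD ?rpredM ?rpred0 ?intr_int ?natr_int.
Qed.

Lemma conj_quad (d : nat) (r s : rat) :
  (ratr r + ratr s * sqrtN d)^* = ratr r - ratr s * sqrtN d.
Proof.
have conj_ratr q : (ratr q : algC)^* = ratr q.
  by rewrite conj_Creal // Creal_Crat //; apply/CratP; exists q.
rewrite (rmorphD _ (ratr r)) (rmorphM _ (ratr s)) /=.
by rewrite !conj_ratr conj_sqrtN mulrN.
Qed.

Lemma norm_quad (d : nat) (r s : rat) :
  let x := ratr r + ratr s * sqrtN d in
  x * x^* = ratr (r ^+ 2 + d%:R * s ^+ 2).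
Proof.
rewrite /= conj_quad rmorphD rmorphM !rmorphXn /= rmorph_nat.
have : sqrtN d ^+ 2 = - d%:R by rewrite sqrtCK.
move: (sqrtN d) => t; rewrite expr2 => tt.
have -> : d%:R = - (t * t) by rewrite tt opprK.
ring.
Qed.

Lemma Aint_ratr (q : rat) : ratr q \in Aint -> q \is a Num.int.
Proof.
by move=> q_int; rewrite -Cint_rat Cint_rat_Aint //; apply/CratP; exists q.
Qed.

(** The trace and norm are the sum and product of two conjugate algebraic integers, and a rational
    algebraic integer is an integer. *)
Lemma trace_norm_int (d : nat) (r s : rat) :
    ratr r + ratr s * sqrtN d \in Aint ->
  2 * r \is a Num.int /\ r ^+ 2 + d%:R * s ^+ 2 \is a Num.int.
Proof.
move=> x_int; have xc_int : (ratr r + ratr s * sqrtN d)^* \in Aint.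
  by rewrite Aint_aut.
split; apply: Aint_ratr; last by rewrite -norm_quad rpredM.
suff -> : ratr (2 * r) = ratr r + ratr s * sqrtN d +
    (ratr r + ratr s * sqrtN d)^* :> algC by apply: rpredD.
by rewrite conj_quad rmorphM /= rmorph_nat; ring.
Qed.

Lemma norm_quad_ge1 (d : nat) (r s : rat) :
    ratr r + ratr s * sqrtN d \in Aint -> ratr r + ratr s * sqrtN d != 0 ->
  1 <= r ^+ 2 + d%:R * s ^+ 2.
Proof.
move=> x_int x_neq0; have [_ /intrP[m m_eq]] := trace_norm_int x_int.
have : 0 < ratr (r ^+ 2 + d%:R * s ^+ 2) :> algC.
  by rewrite -norm_quad mul_conjC_gt0.
by rewrite ltr0q m_eq ltr0z ler1z gtz0_ge1.
Qed.

(** With t = 2r and m the norm, k = 4m - t^2 = p(2s)^2 lies between 0 and 4 * 16 = 64. As p divides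
    k and p > 64, k vanishes. *)
Lemma int_of_small_norm (p : nat) (r s : rat) :
    prime p -> (64 < p)%N -> 2 * r \is a Num.int ->
    r ^+ 2 + p%:R * s ^+ 2 \is a Num.int -> r ^+ 2 + p%:R * s ^+ 2 <= 16 ->
  s = 0.
Proof.
move=> p_prime p_gt64 /intrP[t t_eq] /intrP[m m_eq]; rewrite m_eq => m_le.
have m_le' : m <= 16 by rewrite -(ler_int rat).
pose k := 4 * m - t ^+ 2.
have k_eq : p%:R * (2 * s) ^+ 2 = k%:~R.
  rewrite /k rmorphB rmorphM rmorphXn /= -m_eq -t_eq; ring.
(* The rational 2ps is a root of X^2 - pk, hence an integer [n]. *)
have : (p%:R * (2 * s) : rat) \is a Num.int.
  apply: Aint_ratr; apply: (@Aint_quadratic 0 (- (p%:R * k))).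
  have -> : (- (p%:R * k))%:~R = ratr (- (p%:R * (p%:R * (2 * s) ^+ 2))) :> algC.
    by rewrite k_eq -[LHS]ratr_int rmorphN rmorphM /= rmorph_nat.
  rewrite mulr0z mul0r addr0 -rmorphXn -rmorphD /=.
  by apply/eqP; rewrite fmorph_eq0; apply/eqP; ring.
move=> /intrP[n n_eq].
have nn : n ^+ 2 = p%:R * k.
  by apply: (@intr_inj rat); rewrite rmorphXn rmorphM /= -n_eq -k_eq; ring.
have k_ge0 : 0 <= k.
  by rewrite -(ler_int rat) -k_eq mulr_ge0 ?ler0n ?sqr_ge0.
have k_le : k <= 64 by rewrite /k; have := sqr_ge0 t; lia.
(* From n^2 = pk, p divides n; writing n = qp gives k = q^2 p. *)
have k_dvd : (p %| `|k|)%N.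
  have nn' : (`|n| ^ 2 = p * `|k|)%N.
    by have := congr1 absz nn; rewrite abszX abszM; lia.
  have : (p %| `|n| ^ 2)%N by rewrite nn' dvdn_mulr.
  rewrite Euclid_dvdX // => /andP[/dvdnP[q n_q] _].
  apply/dvdnP; exists (q ^ 2)%N; apply/eqP.
  by rewrite -(eqn_pmul2l (prime_gt0 p_prime)) -nn' n_q; apply/eqP; ring.
have k0 : k = 0.
  have [|k_gt0] := posnP `|k|; first lia.
  by have := dvdn_leq k_gt0 k_dvd; lia.
move: k_eq; rewrite k0 => /eqP; rewrite mulf_eq0 pnatr_eq0.
by rewrite gtn_eqF ?prime_gt0 //= expf_eq0 /= mulf_eq0 => /eqP.
Qed.

(** * Products of ideals, and first elements of the ring of integers *)

Lemma ideal_mul_mem (I J : set algC) (x y : algC) :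
  I x -> J y -> ideal_mul I J (x * y).
Proof.
move=> Ix Jy; exists [:: (x, y)]; last by rewrite big_seq1.
by move=> u; rewrite inE => /eqP ->.
Qed.

Lemma ideal_mul_sub (R I J : set algC) :
  is_ideal R I -> (J `<=` R)%classic -> (ideal_mul I J `<=` I)%classic.
Proof.
case=> _ I0 ID IM J_sub x [s s_in ->].
rewrite big_seq; elim/big_ind: _ => // u /s_in[Iu Ju].
by rewrite mulrC; apply: IM => //; apply: J_sub.
Qed.

Lemma quad_int_intr (d : nat) (m : int) : quad_int d m%:~R.
Proof.
split; last by rewrite /= rpred_int.
by exists m%:~R, 0; rewrite !(rmorph0, mul0r, addr0) ratr_int.
Qed.

Lemma ratr_half : ratr (1 / 2) = 1 / 2 :> algC.
Proof. by rewrite fmorph_div rmorph1 rmorph_nat. Qed.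

Lemma half_not_Aint : (1 / 2 : algC) \notin Aint.
Proof.
apply/negP; rewrite -ratr_half => /Aint_ratr/intrP[m m_eq].
have : (1 : int) = 2 * m.
  by apply: (@intr_inj rat); rewrite rmorphM /= -m_eq; field.
lia.
Qed.

(** * A prime ideal above 2 when p is 7 modulo 8 *)

Section ClassOrder.
Variables (p : nat) (P : set algC).
Hypotheses (p_prime : prime p) (p_gt64 : (64 < p)%N).
Hypothesis p_mod8 : p = 7 %[mod 8].
Hypothesis P_above2 : prime_ideal_above (quad_int p) 2 P.

Let omega : algC := (1 + sqrtN p) / 2.

(** The norm of [omega] is (p + 1) / 4, which is even because p is 7 modulo 8. *)
Lemma omega_sqr : omega ^+ 2 = omega - (2 * (p %/ 8).+1)%:R.
Proof.
have : sqrtN p ^+ 2 = - (8 * (p %/ 8) + 7)%:R.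
  by rewrite sqrtCK {1}(divn_eq p 8) p_mod8 mulnC.
rewrite /omega; move: (sqrtN p) => t.
rewrite natrD !natrM => tt.
have -> : ((1 + t) / 2) ^+ 2 = (1 + 2 * t + t ^+ 2) / 4 by field.
by rewrite tt -[(p %/ 8).+1]addn1 natrD; field.
Qed.

Lemma omega_quad : omega = ratr (1 / 2) + ratr (1 / 2) * sqrtN p.
Proof. by rewrite ratr_half /omega; field. Qed.

Lemma conj_omega : omega^* = 1 - omega.
Proof. by rewrite omega_quad conj_quad ratr_half; field. Qed.

Lemma quad_int_omega : quad_int p omega.
Proof.
split; first by exists (1 / 2), (1 / 2); apply: omega_quad.
apply: (@Aint_quadratic (- 1) (2 * (p %/ 8).+1)%N).
by rewrite omega_sqr mulrN1z; ring.
Qed.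

Lemma quad_int_conj_omega : quad_int p (1 - omega).
Proof.
have [[r [s omega_eq]] omega_int] := quad_int_omega.
split; last by rewrite /= -conj_omega Aint_aut.
by exists r, (- s); rewrite -conj_omega omega_eq conj_quad rmorphN mulNr.
Qed.

Let P_ideal : is_ideal (quad_int p) P.
Proof. by case: P_above2 => [[]]. Qed.

(** An odd m = 2n + 1 in [P] would put 1 = m - 2n in [P]. *)
Let int_P (m : int) : P m%:~R -> (2 %| m)%Z.
Proof.
case: P_ideal => _ _ PD PM Pm; apply: contraT => m_odd.
have [n m_eq] : exists n, m = 2 * n + 1 by exists (m %/ 2)%Z; lia.
case: P_above2 => [[_ P1 _] P2]; case: P1.
have -> : 1 = m%:~R + (- n)%:~R * 2 :> algC.
  by rewrite m_eq rmorphD rmorphM rmorphN /=; ring.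
by apply: PD => //; apply: PM => //; apply: quad_int_intr.
Qed.

(** The even norm [omega * (1 - omega)] lies in [P], so by primality one factor does; both factors
    are roots of the same quadratic, of trace 1. *)
Let P_omega : exists pi : algC,
  [/\ P pi, pi ^+ 2 = pi - (2 * (p %/ 8).+1)%:R & pi + pi^* = 1].
Proof.
case: P_above2 => [[[_ _ _ PM] _ P_prime] P2].
have : P (omega * (1 - omega)).
  rewrite mulrBr mulr1 -expr2 omega_sqr opprB addrCA subrr addr0 mulnC natrM.
  by apply: PM => //; apply: quad_int_intr (Posz _).
case/(P_prime _ _ quad_int_omega quad_int_conj_omega) => [Pw|Pw].
  by exists omega; rewrite omega_sqr conj_omega; split=> //; ring.
exists (1 - omega); split=> //; last by rewrite rmorphB rmorph1 /= conj_omega; ring.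
have -> : (1 - omega) ^+ 2 = 1 - 2 * omega + omega ^+ 2 by ring.
by rewrite omega_sqr; ring.
Qed.

Lemma class_order_neq2 :
  ~ ideal_equiv (quad_int p) (ideal_exp (quad_int p) P 2) (quad_int p).
Proof.
case: P_ideal => P_sub _ _ _.
set P2 := ideal_exp _ _ _ => -[a [b [_ _ a_neq0 b_neq0 /seteqP[P2_sub sub_P2]]]].
have P_unit : (ideal_mul P (quad_int p) `<=` P)%classic.
  exact: ideal_mul_sub P_ideal _.
have P2_P : (P2 `<=` P)%classic.
  by apply: ideal_mul_sub P_ideal _ => x /P_unit /P_sub.
have P2_mul x y : P x -> P y -> P2 (x * y).
  move=> Px Py; apply: ideal_mul_mem => //; rewrite -[y]mulr1.
  by apply: ideal_mul_mem => //; apply: (quad_int_intr p 1).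
(* From a P^2 = b O, the element g = b / a lies in P^2 and generates it. *)
have [g P2g ag] : exists2 g, P2 g & a * g = b.
  have [|g P2g ag] := sub_P2 b; last by exists g.
  by exists 1; rewrite ?mulr1 //; apply: (quad_int_intr p 1).
have P2_gen x : P2 x -> exists2 y, quad_int p y & x = g * y.
  move=> P2x; have [|y Oy ay] := P2_sub (a * x); first by exists x.
  by exists y => //; apply: (mulfI a_neq0); rewrite mulrA ag ay.
have Pg := P2_P _ P2g; have [[r [s g_eq]] g_int] := P_sub _ Pg.
have P_2 : P 2 by case: P_above2.
(* Since 4 = 2 * 2 lies in P^2, [g] divides 4, so the norms of [g] and [y] multiply to 16. *)
have [y [[r' [s' y_eq]] y_int] gy] := P2_gen _ (P2_mul _ _ P_2 P_2).
have [r_int norm_int] : 2 * r \is a Num.int /\ r ^+ 2 + p%:R * s ^+ 2 \is a Num.int.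
  by apply: trace_norm_int; rewrite -g_eq.
have norm_le : r ^+ 2 + p%:R * s ^+ 2 <= 16.
  have norm_y : 1 <= r' ^+ 2 + p%:R * s' ^+ 2.
    apply: norm_quad_ge1; rewrite -y_eq //; apply: contra_eq_neq gy => ->.
    by rewrite mulr0 -natrM pnatr_eq0.
  have norm_g_ge0 : 0 <= r ^+ 2 + p%:R * s ^+ 2.
    by rewrite addr_ge0 ?sqr_ge0 // mulr_ge0 ?ler0n ?sqr_ge0.
  suff norm_gy : (r ^+ 2 + p%:R * s ^+ 2) * (r' ^+ 2 + p%:R * s' ^+ 2) = 16.
    by rewrite -norm_gy ler_peMr.
  apply: (fmorph_inj (ratr : {rmorphism rat -> algC})).
  rewrite rmorphM /= -!norm_quad -g_eq -y_eq mulrACA -rmorphM /= -gy.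
  by rewrite -natrM !rmorph_nat -natrM.
have s0 := int_of_small_norm p_prime p_gt64 r_int norm_int norm_le.
move: g_eq g_int; rewrite s0 rmorph0 mul0r addr0 => g_eq; rewrite /= g_eq.
case/Aint_ratr/intrP => m r_eq; rewrite r_eq ratr_int in g_eq.
move: Pg; rewrite g_eq => /int_P /dvdzP[n m_eq].
have [pi [P_pi pi_sqr pi_trace]] := P_omega.
have [c [_ /= c_int] pi_c] := P2_gen _ (P2_mul _ _ P_pi P_pi).
(* With g = 2n and pi^2 = gc, the quadratic relation for [pi] expresses it as twice an algebraic
   integer. *)
have half_pi_int : pi / 2 \in Aint.
  have -> : pi / 2 = n%:~R * c + (p %/ 8).+1%:R.
    have -> : pi = pi * pi + (2 * (p %/ 8).+1)%:R by rewrite -expr2 pi_sqr; ring.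
    by rewrite pi_c g_eq m_eq rmorphM natrM /=; field.
  by rewrite rpredD ?rpredM ?rpred_int ?rpred_nat.
have conj_half : pi^* / 2 = (pi / 2)^* by rewrite fmorph_div rmorph_nat.
(* The trace of [pi / 2] would be the algebraic integer 1/2. *)
apply: (negP half_not_Aint).
have -> : 1 / 2 = pi / 2 + (pi / 2)^* by rewrite -conj_half -mulrDl pi_trace.
by rewrite rpredD // Aint_aut.
Qed.

End ClassOrder.

End QuadraticIntegers.

Theorem theorem35 (p : nat) (hp : prime p)
    (hp120 : p = 71 %[mod 120] \/ p = 119 %[mod 120])
    (P : set algC)
    (hP : prime_ideal_above (ring_of_integers (imag_quad_field p)) 2 P)
    (L : nat)
    (hL : is_class_order (ring_of_integers (imag_quad_field p)) P L)
    (a b : 'I_(2 * L)) (ha : is_floor a) (hb : is_floor b) (hab : a != b) :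
  diam (add_edge (@stacked_component L) a b) = diam (@stacked_component L).
Proof.
have p_mod120 : p %% 120 = 71 \/ p %% 120 = 119 by case: hp120 => ->; auto.
apply: diam_stacked_add_edge => //; apply/eqP => L_eq; case: hL => _.
(* Both residues modulo 120 are 7 modulo 8 and force p >= 71 > 64. *)
rewrite L_eq => order2 _; apply: class_order_neq2 order2 => //; lia.
Qed.
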